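(* The set $\mathcal{S}_{\rm BH}$ of the BH-separable functions is a meagre subset, for the Fréchet topology, of the space $\mathcal{C}^\infty(U,\mathbb{R})$ of smooth real functions defined on the open ball $U=B(O,1)$ of $\mathbb{R}^n$.
   Context: $U=B(O,1)$ is the open unit ball centered at the origin $O$ of $\mathbb{R}^n$, and $(x_1,\dots,x_n)$ are the standard coordinates on $\mathbb{R}^n$. A function $H\in\mathcal{C}^\infty(U,\mathbb{R})$ is called BH-separable if there exist an open neighborhood $V\subset U$ of $O$ and a smooth diffeomorphism $\varphi=(u_1,\dots,u_n)$ (depending on $H$) from $V$ onto its image $W\subset\mathbb{R}^n$, an open set, with $\varphi(O)=O$, together with smooth real functions of one real variable $H_j$ and $x_{ij}$ ($1\le i,j\le n$), such that on $V$ $$H=\sum_{j=1}^n H_j(u_j)\qquad\text{and}\qquad x_i=\sum_{j=1}^n x_{ij}(u_j)\quad\text{for all } i\in\{1,\dots,n\}.$$ In other words, there are new local coordinates $(u_1,\dots,u_n)$ around $O$ such that $\frac{\partial^2 H}{\partial u_k\partial u_l}=\frac{\partial^2 x_i}{\partial u_k\partial u_l}=0$ for all $i$ and all $k\ne l$. $\mathcal{S}_{\rm BH}$ denotes the set of all such functions. The Fréchet topology on $\mathcal{C}^\infty(U,\mathbb{R})$ is the (metrizable) topology of uniform convergence of all partial derivatives of all orders on compact subsets of $U$. A subset of a metric space is said to be meagre if it is contained in a countable union of closed subsets without interior points.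
   Formalization: The formal theorem assumes n ≥ 2: for n = 1 every smooth H is BH-separable (take u_1 = x_1 and H_1 = H), so the set is the whole Baire space C^∞(U,R) and is not meagre. *)

(* Defs.v *)
From HB Require Import structures.
From mathcomp Require Import all_boot all_order all_algebra.
From mathcomp Require Import all_classical all_reals all_analysis.
Set Implicit Arguments.
Unset Strict Implicit.
Unset Printing Implicit Defensive.
Import Order.TTheory GRing.Theory Num.Theory.
Import numFieldNormedType.Exports.
Local Open Scope classical_set_scope.
Local Open Scope ring_scope.

Section Smoothness.
Variables (R : realType) (n : nat).

(* The library norm on 'rV[R]_n is the sup norm; the ball is Euclidean. *)
Definition unit_ball : set 'rV[R]_n :=
  [set x | \sum_(i < n) x ord0 i ^+ 2 < 1].

Definition iter_partial (s : seq 'I_n) (f : 'rV[R]_n -> R) : 'rV[R]_n -> R :=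
  foldr (fun i g => 'D_(delta_mx ord0 i) g) f s.

(* Only meaningful for A open: the values of f outside A are then irrelevant. *)
Definition smooth_on (A : set 'rV[R]_n) (f : 'rV[R]_n -> R) : Prop :=
  forall (s : seq 'I_n) (x : 'rV[R]_n), A x ->
    {for x, continuous (iter_partial s f)} /\
    (forall i : 'I_n, derivable (iter_partial s f) x (delta_mx ord0 i)).

Definition smooth_map_on (A : set 'rV[R]_n) (f : 'rV[R]_n -> 'rV[R]_n) : Prop :=
  forall i : 'I_n, smooth_on A (fun x => f x ord0 i).

Definition smooth1_on (A : set R) (f : R -> R) : Prop :=
  forall (k : nat) (t : R), A t -> derivable (derive1n k f) t 1.

Definition diffeo_on (V W : set 'rV[R]_n) (phi : 'rV[R]_n -> 'rV[R]_n) : Prop :=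
  [/\ open V, open W, phi @` V = W, smooth_map_on V phi &
      exists psi : 'rV[R]_n -> 'rV[R]_n,
        smooth_map_on W psi /\ (forall x, V x -> psi (phi x) = x)].

(* C^oo(U, R), U the open unit ball. An element is represented by its extension
   by zero to R^n, so that Leibniz equality is equality of functions on U. *)
Record Cinf_ball := CinfBall {
  Cinf_fun :> 'rV[R]_n -> R;
  Cinf_smooth : smooth_on unit_ball Cinf_fun;
  Cinf_out : forall x, ~ unit_ball x -> Cinf_fun x = 0 }.

HB.instance Definition _ := gen_eqMixin Cinf_ball.
HB.instance Definition _ := gen_choiceMixin Cinf_ball.

Definition compact_in_ball : set (set 'rV[R]_n) :=
  [set K | compact K /\ K `<=` unit_ball].

Definition Cinf_partials (f : Cinf_ball) :
    prod_topology
      (fun _ : seq 'I_n => {family compact_in_ball, 'rV[R]_n -> R}) :=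
  fun s => iter_partial s f.

(* Fréchet topology: the coarsest one for which every iterated partial
   derivative is continuous towards the topology of uniform convergence on the
   compact subsets of U. *)
HB.instance Definition _ := Uniform.copy Cinf_ball (initial_topology Cinf_partials).

(* phi = (u_1, .., u_n); since phi @` V is open, each u_j(V) is an open subset of
   R, and H_j, x_ij are only required to be smooth there. *)
Definition BH_separable : set Cinf_ball :=
  [set H | exists (V : set 'rV[R]_n) (phi : 'rV[R]_n -> 'rV[R]_n)
                  (h : 'I_n -> R -> R) (xi : 'I_n -> 'I_n -> R -> R),
    let u j x := phi x ord0 j in
    [/\ V 0, V `<=` unit_ball, diffeo_on V (phi @` V) phi & phi 0 = 0] /\
    [/\ forall j, smooth1_on (u j @` V) (h j),
        forall i j, smooth1_on (u j @` V) (xi i j),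
        forall x, V x -> H x = \sum_(j < n) h j (u j x) &
        forall i x, V x -> x ord0 i = \sum_(j < n) xi i j (u j x)]].

End Smoothness.

Lemma initial_cvgP (S : choiceType) (T : topologicalType) (w : S -> T)
  (F : set_system (initial_topology w)) (f : initial_topology w) : Filter F ->
  F --> f <-> w @ F --> w f.
Proof.
move=> FF; split=> [cF|cF].
  apply: cvg_trans; first exact: (cvg_fmap2 cF).
  exact: initial_continuous.
move=> U [B /= [[W oW <-] Wf WU]].
by apply: (filterS WU); apply: cF; exact: open_nbhs_nbhs.
Qed.

Lemma prod_cvgP (I : Type) (T : I -> topologicalType)
  (F : set_system (prod_topology T)) (f : prod_topology T) : Filter F ->
  F --> f <-> forall i, (fun g : prod_topology T => g i) @ F --> f i.
Proof.
move=> FF; rewrite cvg_sup; split=> H i; have := H i; rewrite initial_cvgP //.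
Qed.

Lemma Cinf_cvgP (R : realType) (n : nat) (F : set_system (Cinf_ball R n))
    (f : Cinf_ball R n) : Filter F ->
  F --> f <->
  forall (s : seq 'I_n) (K : set 'rV[R]_n), compact K -> K `<=` @unit_ball R n ->
  forall e : R, 0 < e -> \forall g \near F, forall x, K x ->
    `|iter_partial s f x - iter_partial s (g : Cinf_ball R n) x| < e.
Proof.
move=> FF.
have -> : F --> f <-> forall s, (fun g => Cinf_partials g s) @ F --> Cinf_partials f s.
  rewrite (@initial_cvgP _ _ (@Cinf_partials R n)) prod_cvgP; split; exact.
split=> [H s K cK KU e e0|H s].
  move: (H s) => /fam_cvgP /(_ K (conj cK KU)) c.
  suff N : nbhs (Cinf_partials f s : {uniform` K -> R}) [set h | forall x, K x -> `|iter_partial s f x - h x| < e] by exact: (c _ N).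
  apply/uniform_nbhs; exists [set xy : R * R | `|xy.1 - xy.2| < e]; split.
    exact: (entourage_ball (R : pseudoMetricType R) (PosNum e0)).
  by move=> h hP x Kx; apply: hP.
apply/fam_cvgP => K [cK KU] P /uniform_nbhs [E [/=]].
rewrite -entourage_ballE => -[e /= e0 eE] EP.
have := H s K cK KU e e0; rewrite !near_simpl; apply: filterS => g gP.
by apply: EP => x Kx; apply: eE; exact: gP.
Qed.

Definition meagre (T : topologicalType) (A : set T) : Prop :=
  exists F : nat -> set T,
    (forall k, closed (F k) /\ interior (F k) = set0) /\
    A `<=` \bigcup_k F k.

(* Main.v *)
Require Import Defs.
From mathcomp Require Import all_boot all_order all_algebra.
From mathcomp Require Import all_classical all_reals all_analysis.
From mathcomp Require Import ring lra zify.

(** A BH-separable function is additive on small grids. Let [psi] be the inverse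
of the chart and let only the first two coordinates [u_0], [u_1] vary, each over
[N] values: the [N ^ 2] points [psi (t_a, t_b, 0, ..)] have the form [Y_a + Z_b],
because every [x_i] is a sum of functions of single [u_j], and the values of [H]
there have the form [f_a + g_b] for the same reason. Such a configuration
[(Y, Z, f, g)] depends on only [2 N (n + 1)] real numbers while it imposes
[N ^ 2] values of [H]; for [N = 2 n + 3] the conditions outnumber the parameters,
which a generic function does not tolerate. The points are distinct because [psi]
is injective, and they are close to the origin because [psi] is continuous.

To turn this into meagreness, the grids are sorted into countably many families.
Some form [x |-> \sum_i s ^ i * x_i] with [s] a natural number separates the points
of the grid ([exists_separating_moment_form]), and some positive integer [k] bounds
all the parameters as well as the inverses of the gaps between the values of the
form. Fix [s] and [k]. The set [grid_additive] of the functions that are additive,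
up to arbitrarily small errors, on a grid of this family is closed, since only
values at points of a compact box are concerned ([closed_grid_additive]).

It has empty interior ([grid_additive_no_interior]): otherwise it would contain a
whole cube of perturbations of some [H] by polynomials of degree less than [N ^ 2] in
the separating form. By Lagrange interpolation, with constants controlled by the
gaps ([lagrange_stability]), the [N ^ 2] coefficients of the perturbation depend
in a Lipschitz way on the [2 N (n + 1)] parameters of the grid, the function [H]
itself being Lipschitz on the box ([lipschitz_on_box]). A cube cannot be a Lipschitz
image of a bounded set of smaller dimension: count boxes ([box_counting]). *)

Set Implicit Arguments.
Unset Strict Implicit.
Unset Printing Implicit Defensive.
Import Order.TTheory GRing.Theory Num.Theory numFieldNormedType.Exports.
Local Open Scope classical_set_scope.
Local Open Scope ring_scope.

(** * Box counting *)

(** Cut the parameter cube into [(A T).+1 ^ #|I|] cells of side [rho]. The target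
cube contains [T ^ #|J|] lattice points, any two of which differ by at least
[eta / T] in some coordinate: more than there are cells once [T] is large, whereas
two points served by the same cell differ by less than [eta / T].
[E rho v eps] is to be thought of as: the parameters [v] produce [eps] up to an
error controlled by [rho]; tolerating this error spares a compactness argument on
the parameters. *)
Lemma box_counting (R : realType) (I J : finType) (K eta C : R)
    (E : R -> (I -> R) -> (J -> R) -> Prop) :
  (#|I| < #|J|)%N -> 0 < K -> 0 < eta ->
  (forall rho eps, 0 < rho -> (forall j, 0 <= eps j <= eta) ->
     exists v, (forall i, `|v i| <= K) /\ E rho v eps) ->
  (forall rho v v' eps eps', 0 < rho -> E rho v eps -> E rho v' eps' ->
     (forall i, `|v i - v' i| <= rho) ->
     forall j, `|eps j - eps' j| <= C * rho) -> False.
Proof.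
move=> IJ K0 eta0 cover expand.
(* [A] makes [C * rho] smaller than the lattice step, and [T] makes
   [T ^ #|J|] exceed the number of cells. *)
pose A := (Num.truncn (C * (2 * K) / eta)).+1.
have A0 : 0 < A%:R :> R by rewrite ltr0n.
have AC : C * (2 * K) / A%:R < eta.
  by rewrite ltr_pdivrMr// [ltRHS]mulrC -ltr_pdivrMr//; exact: truncnS_gt.
pose T := (A.+1 ^ #|I|).+1.
have T0 : 0 < T%:R :> R by rewrite ltr0n.
pose rho : R := 2 * K / (A * T)%:R.
have rho0 : 0 < rho by rewrite divr_gt0 ?mulr_gt0 ?ltr0n.
pose grid (e : {ffun J -> 'I_T}) (j : J) : R := eta * (e j)%:R / T%:R.
have /choice[v vP] : forall e : {ffun J -> 'I_T}, exists v : I -> R,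
    (forall i, `|v i| <= K) /\ E rho v (grid e).
  move=> e; apply: cover => // j; rewrite /grid.
  apply/andP; split; first by rewrite divr_ge0 ?ler0n// mulr_ge0 ?ler0n// ltW.
  rewrite ler_pdivrMr// ler_pM2l// ler_nat.
  exact/ltnW/ltn_ord.
have shift_ge0 e i : 0 <= (v e i + K) / rho.
  have [/(_ i) + _] := vP e; rewrite ler_norml => /andP[vK _].
  by rewrite divr_ge0 ?(ltW rho0)//; lra.
have cell_lt e i : (Num.truncn ((v e i + K) / rho) < (A * T).+1)%N.
  rewrite ltnS truncn_le_nat// ltr_pdivrMr//.
  have -> : (A * T).+1%:R * rho = 2 * K + rho.
    rewrite -addn1 natrD mulrDl mul1r /rho mulrCA divff ?mulr1//.
    by rewrite pnatr_eq0 muln_eq0.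
  have [/(_ i) + _] := vP e; rewrite ler_norml => /andP[_ vK].
  by rewrite ltr_pwDr// mulr_natl mulr2n lerD2r.
pose cell (e : {ffun J -> 'I_T}) : {ffun I -> 'I_(A * T).+1} :=
  [ffun i => Ordinal (cell_lt e i)].
have /injectiveP cell_inj : injectiveb cell.
  apply/injectiveP => e e' /ffunP ee'; apply/ffunP => j; apply/val_inj => /=.
  have close i : `|v e i - v e' i| <= rho.
    have /(congr1 val) := ee' i; rewrite !ffunE /= => tt'.
    have /andP[l1 u1] := truncn_itv (shift_ge0 e i).
    have /andP[l2 u2] := truncn_itv (shift_ge0 e' i).
    rewrite tt' in l1 u1.
    have : `|(v e i + K) / rho - (v e' i + K) / rho| <= 1.
      rewrite ler_norml; move: l1 u1 l2 u2; rewrite -addn1 natrD.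
      by move=> *; apply/andP; split; lra.
    rewrite -mulrBl normrM (gtr0_norm (x := rho^-1)) ?invr_gt0//.
    rewrite ler_pdivrMr// mul1r.
    by congr (`|_| <= _); ring.
  have := expand _ _ _ _ _ rho0 (vP e).2 (vP e').2 close j.
  rewrite /grid -mulrBl -mulrBr 2!normrM (gtr0_norm eta0).
  rewrite (gtr0_norm (x := T%:R^-1)) ?invr_gt0// ler_pdivrMr//.
  have -> : C * rho * T%:R = C * (2 * K) / A%:R.
    rewrite /rho natrM; field; apply/andP; split; exact: lt0r_neq0.
  move=> /le_lt_trans/(_ AC); rewrite gtr_pMr// ltNge => /negP lt1.
  have [//|ne] := eqVneq (val (e j)) (val (e' j)).
  case: lt1.
  case: (ltngtP (val (e j)) (val (e' j))) ne => // lt _.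
    by rewrite distrC -natrB 1?ltnW// normr_nat ler1n subn_gt0.
  by rewrite -natrB 1?ltnW// normr_nat ler1n subn_gt0.
have := leq_card cell cell_inj; rewrite !card_ffun !card_ord.
apply/negP; rewrite -ltnNge.
apply: (@leq_ltn_trans ((A.+1 * T) ^ #|I|)).
  by case: #|I| => // m; rewrite leq_exp2r// mulSn -[(A * T).+1]add1n leq_add2r.
rewrite expnMn; apply: (@leq_trans (T ^ #|I|.+1)); last by rewrite leq_pexp2l.
by rewrite expnS ltn_pmul2r ?expn_gt0.
Qed.

(** * Lagrange interpolation *)

Section Lagrange.
Variables (F : fieldType) (J : finType) (y : J -> F).

Definition lagrange_poly (a : J) : {poly F} :=
  \prod_(b | b != a) ((y a - y b)^-1 *: ('X - (y b)%:P)).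

Lemma horner_lagrange_poly (a : J) (z : F) :
  (lagrange_poly a).[z] = \prod_(b | b != a) ((z - y b) / (y a - y b)).
Proof.
rewrite horner_prod; apply: eq_bigr => b _.
by rewrite hornerZ hornerXsubC mulrC.
Qed.

Lemma size_lagrange_poly (a : J) : (size (lagrange_poly a) <= #|J|)%N.
Proof.
rewrite /lagrange_poly scaler_prod; apply: leq_trans (size_scale_leq _ _) _.
rewrite size_prod => [|b _]; last by rewrite polyXsubC_eq0.
under eq_bigr do rewrite size_XsubC.
have -> : (\sum_(b | b != a) 2 = #|J|.-1 * 2)%N.
  by rewrite -(cardC1 a) -sum_nat_const; apply: eq_bigl.
have -> : #|(fun b => b != a)| = #|J|.-1.
  by rewrite -(cardC1 a); apply: eq_card.
have : (0 < #|J|)%N by apply/card_gt0P; exists a.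
by case: #|J| => // m _ /=; lia.
Qed.

Lemma size_lagrange_sum (e : J -> F) :
  (size (\sum_a e a *: lagrange_poly a)%R <= #|J|)%N.
Proof.
elim/big_rec: _ => [|a u _ su]; first by rewrite size_poly0.
apply: leq_trans (size_polyD _ _) _; rewrite geq_max su andbT.
exact: leq_trans (size_scale_leq _ _) (size_lagrange_poly _).
Qed.

Hypothesis y_inj : injective y.

Lemma lagrange_polyE (a b : J) : (lagrange_poly a).[y b] = (a == b)%:R.
Proof.
rewrite horner_lagrange_poly; have [->|ab] := eqVneq a b.
  by rewrite big1 // => c cb; rewrite divff// subr_eq0 (inj_eq y_inj) eq_sym.
by rewrite (bigD1 b) 1?eq_sym//= subrr !mul0r.
Qed.

Lemma horner_lagrange_sum (e : J -> F) (b : J) :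
  (\sum_a e a *: lagrange_poly a).[y b] = e b.
Proof.
rewrite horner_sum (bigD1 b)//= hornerZ lagrange_polyE eqxx mulr1.
rewrite big1 ?addr0// => a ab.
by rewrite hornerZ lagrange_polyE (negbTE ab) mulr0.
Qed.

Lemma lagrange_interpolation (p : {poly F}) : (size p <= #|J|)%N ->
  p = \sum_a p.[y a] *: lagrange_poly a.
Proof.
move=> sp; apply/eqP; rewrite -subr_eq0; apply/negPn/negP => nz.
have := @max_poly_roots _ _ (codom y) nz.
have -> : all (root (p - \sum_a p.[y a] *: lagrange_poly a)) (codom y).
  apply/allP => _ /codomP[b ->]; rewrite rootE hornerD hornerN.
  by rewrite horner_lagrange_sum subrr.
move=> /(_ isT); rewrite map_inj_uniq ?enum_uniq// => /(_ isT).
apply/negP; rewrite -leqNgt size_codom.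
apply: leq_trans (size_polyD _ _) _; rewrite geq_max sp size_polyN /=.
exact: size_lagrange_sum.
Qed.
End Lagrange.

(** The point is that the constant depends on the nodes only through their bound
[B] and their separation [s]: it is uniform over all grids of one family. [M]
bounds each factor [(z - y b) / (y a - y b)] of a Lagrange polynomial. *)
Lemma lagrange_stability (R : realFieldType) (J : finType) (y : J -> R)
    (B M s t z : R) (p : {poly R}) :
  (forall a, `|y a| <= B) -> 0 < s -> (forall a b, a != b -> s <= `|y a - y b|) ->
  1 <= M -> 2 * B <= M * s -> (size p <= #|J|)%N -> `|z| <= B ->
  (forall a, `|p.[y a]| <= t) -> `|p.[z]| <= #|J|%:R * M ^+ #|J| * t.
Proof.
move=> yB s0 sep M1 BM sp zB pt.
have y_inj : injective y.
  move=> a b yab; apply/eqP/negPn/negP => /sep.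
  by rewrite yab subrr normr0 leNgt s0.
have M0 : 0 <= M by exact: le_trans M1.
rewrite (lagrange_interpolation y_inj sp) horner_sum.
apply: (le_trans (ler_norm_sum _ _ _)).
rewrite mulr_natl mulrnAl -[_ *+ #|J|]sumr_const; apply: ler_sum => a _.
rewrite hornerZ normrM mulrC.
apply: ler_pM => //; rewrite horner_lagrange_poly normr_prod.
apply: (@le_trans _ _ (\prod_(b | b != a) M)).
  apply: ler_prod => b ba; rewrite normr_ge0 /= normrM normfV.
  have syab : s <= `|y a - y b| by apply: sep; rewrite eq_sym.
  rewrite ler_pdivrMr; last exact: lt_le_trans syab.
  apply: (@le_trans _ _ (M * s)); last by rewrite ler_wpM2l.
  by apply: le_trans BM; have := ler_normB z (y b); have := yB b; lra.
by rewrite prodr_const ler_weXn2l// max_card.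
Qed.

(** * Smooth functions of several variables *)

(** A directional derivative is the derivative along a line, because the two
difference quotients are the same function. This reduces the mean value theorem
and the chain rule for ridge functions to one real variable. *)
Lemma is_derive_line (R : realType) (V : normedModType R) (f : V -> R)
    (x v : V) (t l : R) :
  is_derive (t *: v + x) v f l -> is_derive t 1 (fun u => f (u *: v + x)) l.
Proof.
have eqD : (fun h : R => h^-1 *: ((f \o shift (t *: v + x)) (h *: v) - f (t *: v + x)))
  = (fun h => h^-1 *: (((fun u => f (u *: v + x)) \o shift t) (h *: 1) - f (t *: v + x))).
  by apply/funext => h /=; rewrite [h *: 1]mulr1 scalerDl addrA.
by case=> df dfE; split; rewrite /derivable /derive -eqD.
Qed.

Lemma line_is_derive (R : realType) (V : normedModType R) (f : V -> R)
    (x v : V) (l : R) :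
  is_derive (0 : R) 1 (fun u => f (u *: v + x)) l -> is_derive x v f l.
Proof.
have eqD : (fun h : R => h^-1 *: ((f \o shift x) (h *: v) - f x))
  = (fun h => h^-1 *: (((fun u => f (u *: v + x)) \o shift 0) (h *: 1) - f (0 *: v + x))).
  by apply/funext => h /=; rewrite [h *: 1]mulr1 addr0 scale0r add0r.
by case=> df dfE; split; rewrite /derivable /derive eqD.
Qed.

Section Smooth.
Variables (R : realType) (n : nat).
Implicit Types (A : set 'rV[R]_n) (f g : 'rV[R]_n -> R) (x y : 'rV[R]_n).

Let coordinate_sum_continuous (F : 'I_n -> R -> R) :
  (forall i, continuous (F i)) -> continuous (fun x => \sum_i F i (x ord0 i)).
Proof.
move=> cF; apply: continuous_big => [|i _]; first exact: add_continuous.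
by move=> x; apply: continuous_comp; [exact: coord_continuous | exact: cF].
Qed.

Lemma open_unit_ball : open (@unit_ball R n).
Proof.
have cF : continuous (fun x : 'rV[R]_n => \sum_i x ord0 i ^+ 2).
  apply: (@coordinate_sum_continuous (fun _ t => t ^+ 2)) => i.
  exact: exprn_continuous.
apply: (@open_comp _ _ _ [set t : R | t < 1]) => [x _|]; first exact: cF.
exact: open_lt.
Qed.

Lemma eq_iter_partial A f g : open A -> (forall x, A x -> f x = g x) ->
  forall s x, A x -> iter_partial s f x = iter_partial s g x.
Proof.
move=> oA fg; elim=> [|i s IH] x Ax /=; first exact: fg.
by apply: near_eq_derive; apply: (filterS IH); exact: open_nbhs_nbhs.
Qed.

Lemma eq_smooth_on A f g : open A -> (forall x, A x -> f x = g x) ->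
  smooth_on A f -> smooth_on A g.
Proof.
move=> oA fg sf s x Ax; have [c d] := sf s x Ax.
have fgs : {near x, iter_partial s f =1 iter_partial s g}.
  by apply: (filterS (eq_iter_partial oA fg s)); exact: open_nbhs_nbhs.
split; last by move=> i; exact: near_eq_derivable fgs (d i).
rewrite /prop_for /continuous_at -(nbhs_singleton fgs).
exact: cvg_trans (near_eq_cvg fgs) c.
Qed.

Lemma iter_partialD A f g : open A -> smooth_on A f -> smooth_on A g ->
  forall s x, A x ->
  iter_partial s (f + g) x = iter_partial s f x + iter_partial s g x.
Proof.
move=> oA sf sg; elim=> [|i s IH] x Ax //=.
rewrite -deriveD; [|by case: (sf s x Ax)|by case: (sg s x Ax)].
by apply: near_eq_derive; apply: (filterS IH); exact: open_nbhs_nbhs.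
Qed.

Lemma smooth_onD A f g : open A -> smooth_on A f -> smooth_on A g ->
  smooth_on A (f + g).
Proof.
move=> oA sf sg s x Ax.
have fgs : {near x, iter_partial s f + iter_partial s g =1 iter_partial s (f + g)}.
  apply: (filterS (P := A)); last exact: open_nbhs_nbhs.
  by move=> y Ay; rewrite (iter_partialD oA sf sg).
have [cf df] := sf s x Ax; have [cg dg] := sg s x Ax.
split; last first.
  by move=> i; apply: near_eq_derivable fgs _; exact: derivableD.
rewrite /prop_for /continuous_at -(nbhs_singleton fgs).
exact: cvg_trans (near_eq_cvg fgs) (continuousD cf cg).
Qed.

Definition box (r : R) : set 'rV[R]_n := [set x | forall i, `|x ord0 i| <= r].

Lemma compact_box r : compact (box r).
Proof.
rewrite (_ : box r = [set x : 'rV[R]_n | forall i, `[- r, r]%classic (x ord0 i)]).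
  by apply: (@rV_compact R n (fun=> `[- r, r]%classic)) => i; exact: segment_compact.
by apply/seteqP; split=> x xr i; have := xr i; rewrite /= in_itv /= ler_norml.
Qed.

Lemma lipschitz_along_axis A f (i : 'I_n) (r L : R) : box r `<=` A -> smooth_on A f ->
  (forall x, box r x -> `|'D_(delta_mx ord0 i) f x| <= L) ->
  forall x d, box r x -> box r (d *: delta_mx ord0 i + x) ->
  `|f (d *: delta_mx ord0 i + x) - f x| <= L * `|d|.
Proof.
move=> rA sf fL.
suff pos x d : 0 <= d -> box r x -> box r (d *: delta_mx ord0 i + x) ->
    `|f (d *: delta_mx ord0 i + x) - f x| <= L * `|d|.
  move=> x d bx bxd; have [d0|d0] := leP 0 d; first exact: pos.
  have := pos (d *: delta_mx ord0 i + x) (- d).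
  by rewrite scaleNr addKr normrN distrC; apply => //; rewrite oppr_ge0 ltW.
move=> d0 bx bxd.
have seg t : 0 <= t <= d -> box r (t *: delta_mx ord0 i + x).
  move=> /andP[t0 td] j; have := bx j; have := bxd j.
  rewrite !mxE eqxx /=; case: eqVneq => _; rewrite ?mulr0 ?add0r// !mulr1.
  by rewrite !ler_norml => /andP[? ?] /andP[? ?]; apply/andP; split; lra.
have der t : 0 <= t <= d -> is_derive t 1 (fun u => f (u *: delta_mx ord0 i + x))
    ('D_(delta_mx ord0 i) f (t *: delta_mx ord0 i + x)).
  move=> td; apply: is_derive_line; apply: DeriveDef => //.
  by have [_] := sf [::] _ (rA _ (seg t td)); apply.
have [t||u] := @MVT_segment R (fun u => f (u *: delta_mx ord0 i + x))
  (fun u => 'D_(delta_mx ord0 i) f (u *: delta_mx ord0 i + x)) 0 d d0.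
- by rewrite in_itv /= => /andP[t0 td]; apply: der; rewrite !ltW.
- apply: derivable_within_continuous => t; rewrite in_itv /= => td.
  by have [] := der t td.
rewrite in_itv /= scale0r add0r subr0 => ud ->.
by rewrite normrM ler_wpM2r// fL//; exact: seg.
Qed.

(** Partial derivatives are bounded on the compact box. Join [x] to [y] by changing
one coordinate at a time; the intermediate points stay in the box, which may fail
in a Euclidean ball. *)
Lemma lipschitz_on_box A f (r : R) : box r `<=` A -> smooth_on A f ->
  exists2 L, 0 <= L & forall rho x y, box r x -> box r y ->
    (forall i, `|x ord0 i - y ord0 i| <= rho) -> `|f x - f y| <= L * rho.
Proof.
move=> rA sf.
have /choice[L LP] (i : 'I_n) : exists L, 0 <= L /\
    forall x, box r x -> `|'D_(delta_mx ord0 i) f x| <= L.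
  have /compact_bounded[M [_ MP]] : compact ('D_(delta_mx ord0 i) f @` box r).
    apply: continuous_compact; last exact: compact_box.
    by apply: continuous_in_subspaceT => x /set_mem /rA Ax; case: (sf [:: i] x Ax).
  exists (`|M| + 1); split=> [|x bx]; first by rewrite addr_ge0.
  by apply: (MP (`|M| + 1)); [rewrite ltr_pwDr ?ler_norm | exists x].
exists (\sum_i L i); first by apply: sumr_ge0 => i _; case: (LP i).
move=> rho x y bx by_ xy.
pose z (m : nat) : 'rV[R]_n := \row_j if (j < m)%N then y ord0 j else x ord0 j.
have bz m : box r (z m) by move=> j; rewrite mxE; case: ifP.
have z0 : z 0%N = x by apply/rowP => j; rewrite mxE.
have zn : z n = y by apply/rowP => j; rewrite mxE ltn_ord.
have zS (i : 'I_n) : z i.+1 = (y ord0 i - x ord0 i) *: delta_mx ord0 i + z i.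
  apply/rowP => j; rewrite !mxE eqxx ltnS /=.
  case: (ltngtP j i) => [ji|ij|/val_inj ->].
  - by rewrite -val_eqE (ltn_eqF ji) mulr0 add0r.
  - by rewrite -val_eqE (gtn_eqF ij) mulr0 add0r.
  - by rewrite eqxx mulr1 subrK.
rewrite distrC -[in f y]zn -[in f x]z0 -(telescope_sumr (fun m => f (z m)))//.
rewrite big_mkord mulr_suml; apply: le_trans (ler_norm_sum _ _ _) _.
apply: ler_sum => i _; rewrite zS; have [L0 LB] := LP i.
apply: (le_trans (lipschitz_along_axis rA sf LB (bz i) _)).
  by rewrite -zS; exact: bz.
by rewrite ler_wpM2l// distrC.
Qed.

Variable c : 'I_n -> R.

Definition linear_form x : R := \sum_i c i * x ord0 i.

Lemma linear_form_line (v x : 'rV[R]_n) t :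
  linear_form (t *: v + x) = linear_form v * t + linear_form x.
Proof.
rewrite /linear_form mulr_suml -big_split; apply: eq_bigr => i _.
by rewrite !mxE /=; ring.
Qed.

Lemma linear_form_delta i : linear_form (delta_mx ord0 i) = c i.
Proof.
rewrite /linear_form (bigD1 i)//= mxE !eqxx mulr1 big1 ?addr0// => j ji.
by rewrite mxE (negbTE ji) andbF mulr0.
Qed.

(** Perturbations constant along the level sets of a linear form: they are
polynomials in one variable, so interpolation at finitely many points separated by
the form is the classical one, and their iterated partial derivatives are again of
this kind. *)
Definition ridge (p : {poly R}) x : R := p.[linear_form x].

Definition ridge_partial (s : seq 'I_n) (p : {poly R}) : {poly R} :=
  foldr (fun i q => c i *: q^`()) p s.

Lemma is_derive_ridge (p : {poly R}) i x :
  is_derive x (delta_mx ord0 i) (ridge p) (ridge (c i *: p^`()) x).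
Proof.
apply: line_is_derive; rewrite /ridge.
under eq_fun do rewrite linear_form_line linear_form_delta.
rewrite hornerZ mulrC.
apply: (@is_derive1_comp _ (horner p) (fun u => c i * u + linear_form x)).
  by rewrite mulr0 add0r; exact: is_derive_poly.
have := is_deriveD (is_deriveZ (c i) (is_derive_id (0 : R) 1))
  (is_derive_cst (linear_form x) (0 : R) 1).
by rewrite addr0 [c i *: 1]mulr1.
Qed.

Lemma iter_partial_ridge (p : {poly R}) s :
  iter_partial s (ridge p) = ridge (ridge_partial s p).
Proof.
elim: s => //= i s ->; apply/funext => x.
exact: (@derive_val _ _ _ _ _ _ _ (is_derive_ridge _ _ _)).
Qed.

Lemma smooth_ridge A (p : {poly R}) : smooth_on A (ridge p).
Proof.
move=> s x _; rewrite iter_partial_ridge; split; last first.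
  by move=> i; have [] := is_derive_ridge (ridge_partial s p) i x.
apply: (@continuous_comp _ _ _ linear_form); last exact: continuous_horner.
by apply: (coordinate_sum_continuous (F := fun i t => c i * t)) => i; exact: mulrl_continuous.
Qed.

Lemma ridge_partial_sum (J : finType) (e : J -> R) (l : J -> {poly R}) s :
  ridge_partial s (\sum_j e j *: l j) = \sum_j e j *: ridge_partial s (l j).
Proof.
elim: s => //= i s ->; rewrite linear_sum scaler_sumr; apply: eq_bigr => j _.
by rewrite /= derivZ !scalerA mulrC.
Qed.

Lemma ridge_sum (J : finType) (e : J -> R) (l : J -> {poly R}) x :
  ridge (\sum_j e j *: l j) x = \sum_j e j * ridge (l j) x.
Proof.
by rewrite /ridge horner_sum; apply: eq_bigr => j _; rewrite hornerZ.
Qed.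

Lemma ridge_bounded (K : set 'rV[R]_n) (p : {poly R}) : compact K ->
  exists2 M, 0 <= M & forall x, K x -> `|ridge p x| <= M.
Proof.
move=> cK; have /compact_bounded[M [_ MP]] : compact (ridge p @` K).
  apply: continuous_compact => //; apply: continuous_subspaceT => x.
  by case: (@smooth_ridge setT p [::] x).
exists (`|M| + 1); first by rewrite addr_ge0.
by move=> x Kx; apply: (MP (`|M| + 1)); [rewrite ltr_pwDr ?ler_norm | exists x].
Qed.

End Smooth.

(** * Perturbations in the Fréchet topology *)

Section Perturbation.
Variables (R : realType) (n : nat).
Implicit Types (H : Cinf_ball R n) (c : 'I_n -> R) (p : {poly R}).

Let perturb_fun H c p (x : 'rV[R]_n) : R :=
  if \sum_i x ord0 i ^+ 2 < 1 then H x + ridge c p x else 0.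

Let perturb_funE H c p x : unit_ball x -> (Cinf_fun H + ridge c p) x = perturb_fun H c p x.
Proof. by rewrite /unit_ball /perturb_fun /= => ->. Qed.

Let smooth_perturb H c p : smooth_on (@unit_ball R n) (Cinf_fun H + ridge c p).
Proof.
exact: smooth_onD (@open_unit_ball R n) (Cinf_smooth H) (smooth_ridge c p).
Qed.

Definition perturb H c p : Cinf_ball R n.
Proof.
apply: (@CinfBall R n (perturb_fun H c p)).
  exact: eq_smooth_on (@open_unit_ball R n) (perturb_funE H c p) (@smooth_perturb H c p).
by rewrite /perturb_fun /unit_ball /= => x /negP/negbTE ->.
Defined.

Lemma iter_partial_perturb H c p s x : unit_ball x ->
  iter_partial s (perturb H c p) x =
  iter_partial s H x + ridge c (ridge_partial c s p) x.
Proof.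
move=> Ux; rewrite -iter_partial_ridge.
rewrite -(iter_partialD (@open_unit_ball R n) (Cinf_smooth H) (smooth_ridge c p))//.
by rewrite -(eq_iter_partial (@open_unit_ball R n) (perturb_funE H c p)).
Qed.

(** The derivatives of the perturbation depend linearly on the coefficients [e], and
those of each [l j] are bounded on every compact set, so small coefficients give a
small perturbation for the Fréchet topology. *)
Lemma nbhs_perturb (J : finType) (l : J -> {poly R}) H c (F : set (Cinf_ball R n)) :
  nbhs H F -> exists2 eta, 0 < eta & forall e : J -> R,
    (forall j, 0 <= e j <= eta) -> F (perturb H c (\sum_j e j *: l j)).
Proof.
pose cubes := filter_from [set eta : R | 0 < eta]
  (fun eta => [set e : J -> R | forall j, 0 <= e j <= eta]).
have cubesF : Filter cubes.
  apply: filter_from_filter; first by exists 1; exact: ltr01.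
  move=> a b a0 b0; exists (Num.min a b); first by rewrite /= lt_min a0.
  move=> e /= eab; split=> j /=; have /andP[-> /=] := eab j.
    by rewrite le_min => /andP[].
  by rewrite le_min => /andP[].
suff cvgH : (fun e : J -> R => perturb H c (\sum_j e j *: l j)) @ cubes --> H.
  by move=> /cvgH [eta /= eta0 etaF]; exists eta => // e /etaF.
apply/Cinf_cvgP => s K cK KU d d0.
have /choice[M MP] (j : J) : exists M, 0 <= M /\
    forall x, K x -> `|ridge c (ridge_partial c s (l j)) x| <= M.
  by have [M] := ridge_bounded c (ridge_partial c s (l j)) cK; exists M.
have S0 : 0 <= \sum_j M j by apply: sumr_ge0 => j _; case: (MP j).
have S1 : 0 < 1 + \sum_j M j by rewrite ltr_pwDl.
exists (d / (1 + \sum_j M j)) => /=; first by rewrite divr_gt0.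
move=> e eP x Kx; rewrite iter_partial_perturb; last exact: KU.
rewrite opprD addNKr normrN ridge_partial_sum ridge_sum.
apply: (@le_lt_trans _ _ (\sum_j d / (1 + \sum_j M j) * M j)).
  apply: le_trans (ler_norm_sum _ _ _) _; apply: ler_sum => j _.
  have /andP[e0 ed] := eP j; have [_ /(_ x Kx) rM] := MP j.
  by rewrite normrM ger0_norm// ler_pM.
by rewrite -mulr_sumr mulrAC ltr_pdivrMr// ltr_pM2l// ltrDr.
Qed.

End Perturbation.

(** * Functions that are additive on a grid *)

Section Grids.
Variables (R : realType) (n N : nat).

(** Indexes the [2 N (n + 1)] real parameters of a configuration [(Y, Z, f, g)]: the
boolean tells [(Y, f)] from [(Z, g)], [Some i] selects the [i]-th coordinate of the
vector, and [None] the prescribed value. *)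
Definition grid_data : finType := (bool * 'I_N * option 'I_n)%type.

Definition node : finType := ('I_N * 'I_N)%type.

Definition grid_point (v : grid_data -> R) (j : node) : 'rV[R]_n :=
  \row_i (v (true, j.1, Some i) + v (false, j.2, Some i)).

Definition grid_value (v : grid_data -> R) (j : node) : R :=
  v (true, j.1, None) + v (false, j.2, None).

Definition fits (c : 'I_n -> R) (r k delta : R) (f : 'rV[R]_n -> R)
    (v : grid_data -> R) : Prop :=
  [/\ forall i, `|v i| <= k,
      forall j, box r (grid_point v j),
      forall j j', j != j' -> k^-1 <=
        `|linear_form c (grid_point v j) - linear_form c (grid_point v j')| &
      forall j, `|f (grid_point v j) - grid_value v j| <= delta].

(** Allowing every positive error, instead of requiring equality, makes the set
closed without extracting a convergent sequence of parameters. *)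
Definition grid_additive (c : 'I_n -> R) (r k : R) : set (Cinf_ball R n) :=
  [set H | forall delta, 0 < delta ->
     exists v, fits c r k delta (H : Cinf_ball R n) v].

Variables (c : 'I_n -> R) (r k : R).
Hypothesis rU : box r `<=` @unit_ball R n.

Lemma closed_grid_additive : closed (grid_additive c r k).
Proof.
move=> H clH delta d0.
have d20 : 0 < delta / 2 by rewrite divr_gt0.
have /clH[g [gF gH]] : nbhs H [set g : Cinf_ball R n |
    forall x, box r x -> `|H x - g x| < delta / 2].
  have /(Cinf_cvgP H) : nbhs H --> H by exact: cvg_id.
  by move=> /(_ [::] _ (@compact_box R n r) rU _ d20).
have [v [vk vr vs vg]] := gF _ d20; exists v; split=> // j.
have := gH _ (vr j); have := vg j.
rewrite !ler_norml ltr_norml => /andP[? ?] /andP[? ?]; apply/andP; split; lra.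
Qed.

Hypothesis r0 : 0 <= r.
Hypothesis k0 : 0 < k.
Hypothesis card_lt : (2 * N * n.+1 < N * N)%N.

Lemma linear_form_box (x : 'rV[R]_n) : box r x ->
  `|linear_form c x| <= (\sum_i `|c i|) * r.
Proof.
move=> xr; rewrite mulr_suml; apply: le_trans (ler_norm_sum _ _ _) _.
by apply: ler_sum => i _; rewrite normrM ler_wpM2l.
Qed.

(** Otherwise every polynomial perturbation in some cube of dimension [N ^ 2] would be
additive on a grid of the family. By interpolation at the values of the form on the
grid, these perturbations would be Lipschitz functions of the fewer parameters of
the grid, against [box_counting]. *)
Lemma grid_additive_no_interior : interior (grid_additive c r k) = set0.
Proof.
apply/seteqP; split=> // H HF.
(* The perturbations are parametrized by their values at the fixed nodes
   [0, 1, .., N ^ 2 - 1]. *)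
pose z (j : node) : R := (enum_rank j)%:R.
have z_inj : injective z.
  by move=> i j /eqP; rewrite /z eqr_nat => /eqP/val_inj/enum_rank_inj.
pose p (e : node -> R) := \sum_j e j *: lagrange_poly z j.
have sp e e' : (size (p e - p e')%R <= #|node|)%N.
  apply: leq_trans (size_polyD _ _) _.
  by rewrite geq_max size_polyN !size_lagrange_sum.
have [eta eta0 etaF] := nbhs_perturb (lagrange_poly z) c HF.
have [L0 L00 HL] := lipschitz_on_box rU (Cinf_smooth H).
have /choice[L LP] (j : node) : exists L, 0 <= L /\
    forall rho x y, box r x -> box r y ->
    (forall i, `|x ord0 i - y ord0 i| <= rho) ->
    `|ridge c (lagrange_poly z j) x - ridge c (lagrange_poly z j) y| <= L * rho.
  have [M M0 ML] := lipschitz_on_box rU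
    (smooth_ridge (A := @unit_ball R n) c (lagrange_poly z j)).
  by exists M.
pose S := L0 + \sum_j L j.
have S0 : 0 <= S by rewrite addr_ge0// sumr_ge0// => j _; case: (LP j).
(* The Lipschitz constant is uniform over the cube of perturbations. *)
have lip e rho x y : (forall j, `|e j| <= 1) -> box r x -> box r y ->
    (forall i, `|x ord0 i - y ord0 i| <= rho) ->
    `|perturb H c (p e) x - perturb H c (p e) y| <= S * rho.
  move=> e1 bx by_ xy.
  have := iter_partial_perturb H c (p e) [::] (rU bx).
  have := iter_partial_perturb H c (p e) [::] (rU by_).
  rewrite /= => -> ->; rewrite !ridge_sum opprD addrACA -sumrB.
  apply: le_trans (ler_normD _ _) _; rewrite mulrDl lerD ?HL// mulr_suml.
  apply: le_trans (ler_norm_sum _ _ _) _; apply: ler_sum => j _.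
  rewrite -mulrBr normrM -[leRHS]mul1r ler_pM//.
  by case: (LP j) => _; apply.
pose B := #|node|%:R + (\sum_i `|c i|) * r.
have B0 : 0 <= B by rewrite addr_ge0// mulr_ge0// sumr_ge0.
pose M := 1 + 2 * B * k.
have M1 : 1 <= M by rewrite lerDl !mulr_ge0// ltW.
have BM : 2 * B <= M * k^-1.
  by rewrite ler_pdivlMr// lerDr.
pose C := #|node|%:R * M ^+ #|node| * (4 + 2 * S).
pose E rho v e := fits c r k rho (perturb H c (p e)) v /\ forall j, `|e j| <= 1.
have := @box_counting R grid_data node k (Num.min eta 1) C E.
apply.
- by rewrite !card_prod card_option card_bool !card_ord.
- exact: k0.
- by rewrite lt_min eta0 ltr01.
- move=> rho e rho0 e01.
  have [|v vP] := etaF e _ rho rho0.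
    by move=> j; have := e01 j; rewrite le_min => /and3P[-> ->].
  exists v; split; first by case: vP.
  split=> // j; have := e01 j; rewrite le_min => /and3P[? _ ?].
  by rewrite ger0_norm.
- move=> rho v v' e e' rho0 [[_ vr vs vf] e1] [[_ vr' _ vf'] e1'] vv' j.
  have close i a : `|grid_point v i ord0 a - grid_point v' i ord0 a| <= 2 * rho.
    rewrite !mxE; have := vv' (true, i.1, Some a); have := vv' (false, i.2, Some a).
    by rewrite !ler_norml => /andP[? ?] /andP[? ?]; apply/andP; split; lra.
  rewrite -(horner_lagrange_sum z_inj e) -(horner_lagrange_sum z_inj e').
  rewrite -/(p e) -/(p e') -hornerN -hornerD -[C * rho]mulrA.
  apply: (@lagrange_stability _ _ (fun i => linear_form c (grid_point v i)) B M k^-1) => //.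
  + by move=> i; apply: le_trans (linear_form_box (vr i)) _; rewrite lerDr.
  + by rewrite invr_gt0.
  + apply: (@le_trans _ _ #|node|%:R); last by rewrite lerDl mulr_ge0// sumr_ge0.
    by rewrite normr_nat ler_nat ltnW.
  + (* Moving the grid from [v] to [v'] changes a coordinate of a point by at
       most [2 rho], hence the perturbed function by at most [2 S rho], and the
       prescribed value by at most [2 rho]; each of the two fits costs another
       [rho]. *)
    move=> i.
    have -> : (p e - p e').[linear_form c (grid_point v i)] =
        perturb H c (p e) (grid_point v i) - perturb H c (p e') (grid_point v i).
      have := iter_partial_perturb H c (p e) [::] (rU (vr i)).
      have := iter_partial_perturb H c (p e') [::] (rU (vr i)).
      by rewrite /= => -> ->; rewrite hornerD hornerN /ridge; ring.
    have := lip e' _ _ _ e1' (vr i) (vr' i) (close i).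
    have := vf i; have := vf' i; rewrite /grid_value.
    have := vv' (true, i.1, None); have := vv' (false, i.2, None).
    rewrite !ler_norml => /andP[? ?] /andP[? ?] /andP[? ?] /andP[? ?] /andP[? ?].
    by apply/andP; split; lra.
Qed.

End Grids.

(** * Grids adapted to a separating chart *)

Lemma poly_nat_nonroot (R : numDomainType) (p : {poly R}) :
  p != 0 -> exists s : nat, p.[s%:R] != 0.
Proof.
move=> nz; apply/not_existsP => H.
have := @max_poly_roots _ p [seq s%:R | s <- iota 0 (size p)] nz.
rewrite map_inj_uniq ?iota_uniq; last first.
  by move=> i j /eqP; rewrite eqr_nat => /eqP.
rewrite size_map size_iota ltnn => contra; apply/notF/contra => //.
apply/allP => _ /mapP[s _ ->].
by rewrite rootE; apply/negPn/negP/H.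
Qed.

(** For two distinct points the difference of the values of the form is a nonzero
polynomial in [s], so only finitely many [s] fail to separate a finite set. Thus a
countable set of forms is enough. *)
Lemma exists_separating_moment_form (R : realType) (n : nat) (J : finType)
    (x : J -> 'rV[R]_n) : injective x ->
  exists s : nat, forall j j', j != j' ->
    linear_form (fun i : 'I_n => s%:R ^+ i) (x j) !=
    linear_form (fun i : 'I_n => s%:R ^+ i) (x j').
Proof.
move=> x_inj.
have [|s] := @poly_nat_nonroot R (\prod_(q : J * J | q.1 != q.2) rVpoly (x q.1 - x q.2)).
  apply/prodf_neq0 => q q12; apply: contraNneq q12 => /(congr1 (@poly_rV R n)).
  by rewrite rVpolyK linear0 => /eqP; rewrite subr_eq0 => /eqP/x_inj ->.
rewrite horner_prod => /prodf_neq0 nz; exists s => j j' jj'.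
have := nz (j, j') jj'; apply: contraNneq => /eqP; rewrite -subr_eq0 /linear_form.
rewrite -sumrB (horner_coef_wide _ (size_poly _ _)) => /eqP eq0.
apply/eqP; rewrite -[RHS]eq0; apply: eq_bigr => i _.
by rewrite coef_rVpoly_ord !mxE /=; ring.
Qed.

Lemma box_unit_ball (R : realType) (n : nat) : box n.+1%:R^-1 `<=` @unit_ball R n.
Proof.
move=> x xr; rewrite /unit_ball /=.
apply: (@le_lt_trans _ _ (\sum_(i < n) n.+1%:R^-1)).
  apply: ler_sum => i _; rewrite -real_normK ?num_real// -[leRHS]mulr1 expr2.
  by apply: ler_pM => //; apply: le_trans (xr i) _; rewrite invf_le1 ?ler1n.
rewrite sumr_const card_ord -[_ *+ n]mulr_natl ltr_pdivrMr// mul1r ltr_nat.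
exact: ltnSn.
Qed.

Lemma grid_in_nbhs (R : realType) (n N : nat) (a0 b0 : 'I_n) (W : set 'rV[R]_n) :
  a0 != b0 -> nbhs (0 : 'rV[R]_n) W -> exists2 t : 'I_N -> R, injective t &
    forall a b : 'I_N,
      W (\row_j if j == a0 then t a else if j == b0 then t b else 0).
Proof.
move=> ab /nbhs_ballP[tau /= tau0 tauW].
exists (fun a : 'I_N => tau * (a%:R / N.+1%:R)).
  move=> a b /(mulfI (lt0r_neq0 tau0)) /(mulIf _) /eqP.
  by rewrite invr_eq0 pnatr_eq0 => /(_ isT); rewrite eqr_nat => /eqP/val_inj.
move=> a b; apply: tauW.
have small (e : 'I_N) : `|0 - tau * (e%:R / N.+1%:R)| < tau.
  rewrite sub0r normrN ger0_norm; last by rewrite mulr_ge0 ?divr_ge0// ltW.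
  by rewrite gtr_pMr// ltr_pdivrMr// mul1r ltr_nat ltnW// ltnS.
by split=> // i j; rewrite !mxE /ball /=; case: ifP => _; [|case: ifP => _] => //;
  rewrite subrr normr0.
Qed.

(** Take the image under the inverse chart [psi] of a small planar grid of the
[u]-space. The constant contributions of the coordinates other than [a0] and [b0]
are put into the first summand. *)
Lemma BH_separable_grid (R : realType) (n N : nat) (H : Cinf_ball R n) :
  (2 <= n)%N -> BH_separable H ->
  exists v : grid_data n N -> R,
    [/\ injective (grid_point v), forall j, box n.+1%:R^-1 (grid_point v j) &
        forall j, H (grid_point v j) = grid_value v j].
Proof.
move=> n2 [V [phi [h [xi /= [[V0 VU [oV oW imV sphi [psi [spsi psiK]]] phi0]]]]]].
move=> [_ _ HE xE].
pose a0 := Ordinal (ltnW n2); pose b0 := Ordinal n2.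
have W0 : (phi @` V) 0 by exists 0.
have psi0 : psi 0 = 0 by rewrite -[in LHS]phi0 psiK.
have r0 : 0 < n.+1%:R^-1 :> R by rewrite invr_gt0.
have : nbhs (0 : 'rV[R]_n) [set t | (phi @` V) t /\ box n.+1%:R^-1 (psi t)].
  apply: (@filterI _ _ _ (phi @` V) [set t | box n.+1%:R^-1 (psi t)]).
    exact: open_nbhs_nbhs.
  have coord i : \forall t \near (0 : 'rV[R]_n), `|psi t ord0 i| <= n.+1%:R^-1.
    have [ci _] := spsi i [::] 0 W0.
    have near_ci : \forall t \near (0 : 'rV[R]_n),
        ball (psi 0 ord0 i) n.+1%:R^-1 (psi t ord0 i).
      exact: (ci _ (nbhsx_ballx _ _ r0)).
    near=> t; have : ball (psi 0 ord0 i) n.+1%:R^-1 (psi t ord0 i) by near: t.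
    by rewrite psi0 /ball /= !mxE sub0r normrN => /ltW.
  exact: filter_forall coord.
move=> /(@grid_in_nbhs R n N a0 b0 _ isT) [t t_inj tW].
pose T (j : node N) : 'rV[R]_n :=
  \row_i if i == a0 then t j.1 else if i == b0 then t j.2 else 0.
have TP j : V (psi (T j)) /\ phi (psi (T j)) = T j.
  by have [[x Vx xT] _] := tW j.1 j.2; rewrite -/(T j) in xT *; rewrite -xT psiK.
have T_inj : injective T.
  move=> [a b] [a' b'] /rowP TT; have := TT a0; have := TT b0.
  by rewrite !mxE /= => /t_inj -> /t_inj ->.
have sumT (g : 'I_n -> R -> R) j : \sum_i g i (T j ord0 i) =
    g a0 (t j.1) + \sum_(i | (i != a0) && (i != b0)) g i 0 + g b0 (t j.2).
  rewrite (bigD1 a0)//= (bigD1 b0)//= !mxE /= -addrA [X in _ + X]addrC.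
  congr (_ + (_ + _)); apply: eq_bigr => i /andP[/negbTE ia /negbTE ib].
  by rewrite mxE ia ib.
pose fam (o : option 'I_n) := if o is Some i then xi i else h.
pose v (d : grid_data n N) : R :=
  if d.1.1 then fam d.2 a0 (t d.1.2) + \sum_(i | (i != a0) && (i != b0)) fam d.2 i 0
  else fam d.2 b0 (t d.1.2).
have vx j : grid_point v j = psi (T j).
  apply/rowP => i; rewrite mxE /v /= -sumT.
  by have [Vx xT] := TP j; rewrite (xE _ _ Vx) xT.
exists v; split.
- move=> j j'; rewrite !vx => /(congr1 phi).
  by rewrite (TP j).2 (TP j').2 => /T_inj.
- by move=> j; rewrite vx; have [_] := tW j.1 j.2.
- move=> j; rewrite vx /grid_value /v /= -sumT.
  by have [Vx xT] := TP j; rewrite (HE _ Vx) xT.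
Unshelve. all: by end_near.
Qed.

Theorem theorem3p5 (R : realType) (n : nat) (hn : (2 <= n)%N) :
  meagre (@BH_separable R n).
Proof.
(* The least [N] with [2 * N * n.+1 < N * N]. *)
pose N := (2 * n + 3)%N.
pose F (s k : nat) := @grid_additive R n N (fun i => s%:R ^+ i) n.+1%:R^-1 k.+1%:R.
exists (fun m => if unpickle m is Some (s, k) then F s k else set0); split.
  move=> m; case: unpickle => [[s k]|]; last by split; [exact: closed0|exact: interior0].
  split; first exact: closed_grid_additive (@box_unit_ball R n).
  apply: grid_additive_no_interior (@box_unit_ball R n) _ _ _ => //.
  by rewrite /N; nia.
move=> H /(BH_separable_grid N hn)[v [v_inj vr vH]].
have [s sP] := exists_separating_moment_form v_inj.
pose gap (q : node N * node N) : R :=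
  `|linear_form (fun i : 'I_n => s%:R ^+ i) (grid_point v q.1) -
    linear_form (fun i : 'I_n => s%:R ^+ i) (grid_point v q.2)|.
(* One number bounds the parameters and the inverse gaps simultaneously. *)
pose bound := \sum_d `|v d| + \sum_q (gap q)^-1.
have gap0 : 0 <= \sum_q (gap q)^-1 by apply: sumr_ge0 => q _; rewrite invr_ge0 normr_ge0.
pose k := Num.truncn bound.
have bk : bound <= k.+1%:R by apply/ltW; exact: truncnS_gt.
exists (pickle (s, k)) => //; rewrite pickleK => delta d0; exists v; split=> //.
- move=> d; apply: le_trans bk; rewrite /bound (bigD1 d)//= -addrA lerDl.
  by rewrite addr_ge0// sumr_ge0.
- move=> j j' jj'; have g0 : 0 < gap (j, j') by rewrite normr_gt0 subr_eq0 sP.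
  rewrite -[leRHS]/(gap (j, j')) -[leRHS]invrK lef_pV2 ?posrE ?invr_gt0//.
  apply: le_trans bk; rewrite /bound [X in _ + X](bigD1 (j, j'))//= addrCA lerDl.
  by rewrite addr_ge0// sumr_ge0// => q _; rewrite invr_ge0 normr_ge0.
- by move=> j; rewrite vH subrr normr0 ltW.
Qed.
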